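(* Let $\Sigma=(A,B,C,D)$ be a linear time-invariant system (in continuous or in discrete time) that satisfies the standing assumptions listed in the context. Let $(\lambda_1,\ldots,\lambda_p)\in\mathbb{R}^p$ be such that, for all $i\in\{1,\dots,p\}$, $\lambda_i\notin\mathcal{Z}$ and $\lambda_i<0$ in continuous time, respectively $\lambda_i\in(0,1)$ in discrete time. Then the Single Mode Problem for $\Sigma$ and $(\lambda_1,\dots,\lambda_p)$ admits a solution $F$ if and only if $$\forall\, S\subseteq\{1,\ldots,p\}:\qquad \dim\Big(\mathcal{V}_g^\star+\sum_{j\in S}\mathcal{R}_j^\star(\lambda_j)\Big)\ \ge\ n-p+\operatorname{card}(S).$$
   Context: **System.** The time set is $\mathbb{R}^+=[0,\infty)$ (continuous time) or $\mathbb{N}=\{0,1,2,\dots\}$ (discrete time). $\mathbb{C}_g$ is the open left half-plane in continuous time and the open unit disc in discrete time. $\Sigma=(A,B,C,D)$ is the system $\mathcal{D}x(t)=Ax(t)+Bu(t)$, $x(0)=x_0$, $y(t)=Cx(t)+Du(t)$, with real matrices $A\in\mathbb{R}^{n\times n}$, $B\in\mathbb{R}^{n\times m}$, $C\in\mathbb{R}^{p\times n}$, $D\in\mathbb{R}^{p\times m}$, $\mathcal{X}=\mathbb{R}^n$, $\mathcal{U}=\mathbb{R}^m$, $\mathcal{Y}=\mathbb{R}^p$; $\mathcal{D}x(t)$ is $\dot x(t)$ in continuous time and $x(t+1)$ in discrete time. **Invariant zeros.** $P_\Sigma(\lambda)=\begin{bmatrix}A-\lambda I_n&B\\ C&D\end{bmatrix}$.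 The set $\mathcal{Z}$ of invariant zeros of $\Sigma$ is the set of $\lambda\in\mathbb{C}$ at which the rank of $P_\Sigma(\lambda)$ is strictly smaller than its normal rank $\max_{\mu\in\mathbb{C}}\operatorname{rank}P_\Sigma(\mu)$; the algebraic multiplicity of an invariant zero is its multiplicity as a root of the product of the non-zero diagonal polynomials of the Smith form of $P_\Sigma$. The minimum-phase invariant zeros are the elements of $\mathcal{Z}\cap\mathbb{C}_g$. **Subspaces.** $\mathcal{V}_g^\star$ is the largest subspace $\mathcal{V}$ of $\mathcal{X}$ for which there is $F\in\mathbb{R}^{m\times n}$ with $(A+BF)\mathcal{V}\subseteq\mathcal{V}\subseteq\ker(C+DF)$ and $\sigma(A+BF\,|\,\mathcal{V})\subset\mathbb{C}_g$. For $j\in\{1,\dots,p\}$, $C_{(j)}$ and $D_{(j)}$ are $C$ and $D$ with the $j$-th row removed, and for $\mu\in\mathbb{R}\setminus\mathcal{Z}$ $$\mathcal{R}_j^\star(\mu)=\Big\{v\in\mathcal{X}\ \Big|\ \exists w\in\mathcal{U}:\ \begin{bmatrix}A-\mu I_n&B\\ C_{(j)}&D_{(j)}\end{bmatrix}\begin{bmatrix}v\\ w\end{bmatrix}=0\Big\}.$$ **Standing assumptions.** (i) The columns of $\begin{bmatrix}B\\ D\end{bmatrix}$ are linearly independent and the rows of $[\,C\;\;D\,]$ are linearly independent. (ii) $\Sigma$ is right invertible (i.e. $P_\Sigma(\lambda)$ has full row rank $n+p$ for all but finitely many $\lambda\in\mathbb{C}$), the pair $(A,B)$ is stabilisable, and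 $\Sigma$ has no invariant zero at $0$ (continuous time), respectively at $1$ (discrete time). (iii) All minimum-phase invariant zeros of $\Sigma$ have algebraic multiplicity one. (iv) $\dim\mathcal{V}_g^\star=n-p$. **Tracking control.** For a constant reference $r\in\mathcal{Y}$, choose $x_{ss},u_{ss}$ with $Ax_{ss}+Bu_{ss}=0$ (continuous time) or $Ax_{ss}+Bu_{ss}=x_{ss}$ (discrete time), and $Cx_{ss}+Du_{ss}=r$. For $F\in\mathbb{R}^{m\times n}$, applying $u(t)=F(x(t)-x_{ss})+u_{ss}$ and setting $\xi=x-x_{ss}$ gives the closed loop $\mathcal{D}\xi(t)=(A+BF)\xi(t)$, with tracking error $\epsilon(t)=y(t)-r=(C+DF)\xi(t)\in\mathbb{R}^p$. The closed loop is asymptotically stable if $\sigma(A+BF)\subset\mathbb{C}_g$. **Single Mode Problem (for $\Sigma$ and $(\lambda_1,\dots,\lambda_p)$).** Find $F\in\mathbb{R}^{m\times n}$ such that the closed loop is asymptotically stable and, from all initial conditions and for all step references, the tracking error has the form $\epsilon_k(t)=\beta_k e^{\lambda_k t}$ (continuous time), respectively $\epsilon_k(t)=\beta_k\lambda_k^t$ (discrete time), for all $t$ and all $k\in\{1,\dots,p\}$, for some real coefficients $\beta_1,\dots,\beta_p$ depending only on $\xi(0)$. *)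

(* Defs.v *)
(* MathComp + MathComp-Analysis. *)
From HB Require Import structures.
From mathcomp Require Import all_boot all_order all_algebra.
From mathcomp Require Import complex.
From mathcomp Require Import all_classical all_reals all_analysis.
Set Implicit Arguments.
Unset Strict Implicit.
Unset Printing Implicit Defensive.
Import Order.TTheory GRing.Theory Num.Theory.
Import numFieldNormedType.Exports.

Local Open Scope classical_set_scope.
Local Open Scope ring_scope.
Local Open Scope complex_scope.

Inductive time_domain := ContinuousTime | DiscreteTime.

Record lti_system (R : realType) (n m p : nat) := LTI {
  sysA : 'M[R]_n;
  sysB : 'M[R]_(n, m);
  sysC : 'M[R]_(p, n);
  sysD : 'M[R]_(p, m) }.

Section Spectrum.
Variable R : realType.

Definition Cgood (tau : time_domain) (z : R[i]) : bool :=
  match tau with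
  | ContinuousTime => complex.Re z < 0
  | DiscreteTime => `|z| < 1
  end.

Definition mxC k l (M : 'M[R]_(k, l)) : 'M[R[i]]_(k, l) :=
  map_mx (real_complex R) M.

Definition invariant_subspace n (M : 'M[R]_n) (V : {vspace 'cV[R]_n}) : Prop :=
  forall v, v \in V -> M *m v \in V.

(* [z] is an eigenvalue of the restriction of [M] to the [M]-invariant real
   subspace [V]: the eigenvectors live in the complexification of [V], that
   is, their real and imaginary parts belong to [V]. *)
Definition eigenvalue_on n (M : 'M[R]_n) (V : {vspace 'cV[R]_n}) (z : R[i]) :
    Prop :=
  exists w : 'cV[R[i]]_n,
    [/\ w != 0,
        map_mx (@complex.Re R) w \in V,
        map_mx (@complex.Im R) w \in V
      & mxC M *m w = z *: w].

Definition stable_matrix (tau : time_domain) n (M : 'M[R]_n) : Prop :=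
  forall z : R[i], eigenvalue (mxC M) z -> Cgood tau z.

End Spectrum.

Section SmithForm.
Variable K : fieldType.

(* Since [0 %| q] forces [q = 0], the divisibility condition also puts the
   zero diagonal entries last. *)
Definition is_Smith_form k l (P S : 'M[{poly K}]_(k, l)) : Prop :=
  [/\ exists2 L : 'M[{poly K}]_k, L \in unitmx &
        exists2 Q : 'M[{poly K}]_l, Q \in unitmx & S = L *m P *m Q,
      forall (i : 'I_k) (j : 'I_l), i <> j :> nat -> S i j = 0,
      forall i j, S i j = 0 \/ S i j \is monic
    & forall (i : 'I_k) (j : 'I_l) (i' : 'I_k) (j' : 'I_l),
        i = j :> nat -> i' = j' :> nat -> (i <= i')%N -> S i j %| S i' j'].

Definition nonzero_diag_prod k l (S : 'M[{poly K}]_(k, l)) : {poly K} :=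
  \prod_(i < k) \prod_(j < l | (i == j :> nat) && (S i j != 0)) S i j.

End SmithForm.

Section System.
Variables (R : realType) (n m p : nat).
Implicit Types (Sigma : lti_system R n m p) (F : 'M[R]_(m, n)).

(* The system pencil with coefficients transported along [f : R -> T] and
   indeterminate [mu : T]; it is used below both for complex numbers and, with
   [mu = 'X], for polynomials. *)
Definition pencil (T : comNzRingType) (f : R -> T) Sigma (mu : T) :
    'M[T]_(n + p, n + m) :=
  block_mx (map_mx f (sysA Sigma) - mu%:M) (map_mx f (sysB Sigma))
           (map_mx f (sysC Sigma)) (map_mx f (sysD Sigma)).

Definition rosenbrock Sigma (z : R[i]) : 'M[R[i]]_(n + p, n + m) :=
  pencil (real_complex R) Sigma z.

Definition rosenbrock_poly Sigma : 'M[{poly R[i]}]_(n + p, n + m) :=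
  pencil (fun a => (a%:C)%:P) Sigma 'X.

Definition normal_rank Sigma : nat :=
  \max_(r < (n + p).+1 | `[< exists z, \rank (rosenbrock Sigma z) = r >]) r.

Definition invariant_zeros Sigma : set R[i] :=
  [set z | (\rank (rosenbrock Sigma z) < normal_rank Sigma)%N].

Definition has_alg_multiplicity Sigma (z : R[i]) (k : nat) : Prop :=
  exists2 S, is_Smith_form (rosenbrock_poly Sigma) S &
    mup z (nonzero_diag_prod S) = k.

Definition right_invertible Sigma : Prop :=
  finite_set [set z : R[i] | \rank (rosenbrock Sigma z) <> (n + p)%N].

Definition closed_loop Sigma F : 'M[R]_n := sysA Sigma + sysB Sigma *m F.

Definition error_map Sigma F : 'M[R]_(p, n) := sysC Sigma + sysD Sigma *m F.

Definition stabilisable tau Sigma : Prop :=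
  exists F, stable_matrix tau (closed_loop Sigma F).

Definition output_nulling_stable tau Sigma (V : {vspace 'cV[R]_n}) : Prop :=
  exists F,
    [/\ invariant_subspace (closed_loop Sigma F) V,
        forall v, v \in V -> error_map Sigma F *m v = 0
      & forall z, eigenvalue_on (closed_loop Sigma F) V z -> Cgood tau z].

Definition is_Vgstar tau Sigma (V : {vspace 'cV[R]_n}) : Prop :=
  output_nulling_stable tau Sigma V /\
  forall W, output_nulling_stable tau Sigma W -> (W <= V)%VS.

Definition pencil_without_row Sigma (j : 'I_p) (mu : R) :
    'M[R]_(n + p.-1, n + m) :=
  block_mx (sysA Sigma - mu%:M) (sysB Sigma)
           (row' j (sysC Sigma)) (row' j (sysD Sigma)).

Definition Rstar Sigma (j : 'I_p) (mu : R) : {vspace 'cV[R]_n} :=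
  (linfun (@usubmx R n m 1) @:
     lker (linfun (mulmx (pencil_without_row Sigma j mu))))%VS.

Lemma mem_Rstar Sigma j mu (v : 'cV[R]_n) :
  v \in Rstar Sigma j mu <->
  exists w : 'cV[R]_m, pencil_without_row Sigma j mu *m col_mx v w = 0.
Proof.
split=> [/memv_imgP[u] | [w Pvw]].
  rewrite memv_ker lfunE /= => /eqP Pu ->; exists (dsubmx u).
  by rewrite lfunE /= vsubmxK.
apply/memv_imgP; exists (col_mx v w); last by rewrite lfunE /= col_mxKu.
by rewrite memv_ker lfunE /= Pvw.
Qed.

End System.

Section Tracking.
Variable R : realType.

(* The carrier of the time set; in continuous time the time set proper is the
   half-line selected by [in_time], and values of signals at negative times
   are irrelevant. *)
Definition time (tau : time_domain) : Type :=
  match tau with ContinuousTime => R | DiscreteTime => nat end.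

Definition in_time (tau : time_domain) : time tau -> Prop :=
  match tau with
  | ContinuousTime => fun t : R => 0 <= t
  | DiscreteTime => fun _ : nat => True
  end.

Definition time0 (tau : time_domain) : time tau :=
  match tau with ContinuousTime => 0 : R | DiscreteTime => 0%N end.

(* In continuous time the derivative is relative to [0, +oo): two-sided at
   positive times and one-sided at time 0. *)
Definition has_evolution (tau : time_domain) n :
    (time tau -> 'cV[R]_n) -> (time tau -> 'cV[R]_n) -> Prop :=
  match tau with
  | ContinuousTime => fun (x dx : R -> 'cV[R]_n) =>
      forall t : R, 0 <= t -> forall i : 'I_n,
        (fun s => (s - t)^-1 * (x s i 0 - x t i 0))
          @ within [set s : R | 0 <= s] (t^') --> dx t i 0
  | DiscreteTime => fun (x dx : nat -> 'cV[R]_n) =>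
      forall t : nat, x t.+1 = dx t
  end.

Definition mode (tau : time_domain) (lambda : R) : time tau -> R :=
  match tau with
  | ContinuousTime => fun t : R => expR (lambda * t)
  | DiscreteTime => fun t : nat => lambda ^+ t
  end.

Variables (n m p : nat).
Implicit Types (Sigma : lti_system R n m p).

Definition steady_state (tau : time_domain) Sigma (r : 'cV[R]_p)
    (xss : 'cV[R]_n) (uss : 'cV[R]_m) : Prop :=
  sysA Sigma *m xss + sysB Sigma *m uss =
    match tau with ContinuousTime => 0 | DiscreteTime => xss end /\
  sysC Sigma *m xss + sysD Sigma *m uss = r.

(* [beta] is chosen before the initial condition, the reference and the steady
   state, and is applied to the initial value of [xi = x - xss] only. *)
Definition solves_single_mode_problem (tau : time_domain) Sigma
    (lambda : 'I_p -> R) (F : 'M[R]_(m, n)) : Prop :=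
  stable_matrix tau (closed_loop Sigma F) /\
  exists beta : 'cV[R]_n -> 'I_p -> R,
    forall (r : 'cV[R]_p) (xss : 'cV[R]_n) (uss : 'cV[R]_m)
           (x : time tau -> 'cV[R]_n) (u : time tau -> 'cV[R]_m),
      steady_state tau Sigma r xss uss ->
      (forall t, u t = F *m (x t - xss) + uss) ->
      has_evolution x (fun t => sysA Sigma *m x t + sysB Sigma *m u t) ->
      forall t, in_time t -> forall k : 'I_p,
        (sysC Sigma *m x t + sysD Sigma *m u t - r) k 0 =
        beta (x (time0 tau) - xss) k * mode (lambda k) t.

End Tracking.

(* Main.v *)
(* A feedback F solves the problem iff A + BF is stable and each row E_k of
   E = C + DF is a left eigenvector, E_k (A + BF) = lambda_k E_k.

   Given such an F, ker E is output nulling and stable, so by maximality and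
   dimension it equals V_g*, and E is onto. Put G(mu) = EB - (Lambda - mu) D,
   where Lambda = diag(lambda). It is onto whenever the system pencil has full
   row rank at mu. For a generic real stable mu, an input w with G(mu) w = 0
   produces a mode of rate mu with zero error, hence lying in V_g*, so
   Dw = EBw = 0; such w are killed by every G(mu'), and comparing dimensions
   ker G(lambda_k) is this same space. Solving the pencil at lambda_k with error
   e_k gives an input in ker G(lambda_k), hence a vector v_k of
   R_k*(lambda_k) with E v_k = e_k, and the dimension inequality follows.

   Conversely, Rado's theorem turns the inequality into vectors v_k of
   R_k*(lambda_k) that complete V_g* to a basis of the state space; the feedback
   that is a friend of V_g* on V_g* and generates the mode v_k on v_k is a
   solution. *)
Require Import Defs.
From HB Require Import structures.
From mathcomp Require Import all_boot all_order all_algebra.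
From mathcomp Require Import complex ring lra.
Set Implicit Arguments.
Unset Strict Implicit.
Unset Printing Implicit Defensive.
Import Order.TTheory GRing.Theory Num.Theory.
Local Open Scope ring_scope.

(** * Rado's theorem relative to a subspace, and dimension counts *)

Section LinearAlgebra.
Variable K : fieldType.

(** Induction on the cardinality of [T], as for Hall's theorem. If some nonempty proper subset is
    tight (equality holds), it is solved first, and its complement in [T] is then solved relative to
    the enlarged base space. Otherwise a vector of some [W i] outside [V] can be adjoined to the
    base space at once. *)
Lemma rado_vspace (vT : vectType K) (I : finType) (V : {vspace vT})
    (W : I -> {vspace vT}) (T : {set I}) :
  (forall S : {set I}, S \subset T ->
     (\dim V + #|S| <= \dim (V + \sum_(j in S) W j)%VS)%N) ->
  exists2 v : I -> vT, (forall j, j \in T -> v j \in W j) &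
    (\dim V + #|T| <= \dim (V + \sum_(j in T) <[v j]>)%VS)%N.
Proof.
have [k] := ubnP #|T|; elim: k => // k IHk in V T *; rewrite ltnS => leTk rkW.
have [-> | [i iT]] := set_0Vmem T.
  exists (fun=> 0) => [j|]; first by rewrite inE.
  by rewrite cards0 addn0 dimvS // addvSl.
have [/existsP[S /and4P[ST S0 nST /eqP tightS]] | /existsPn loose] :=
  boolP [exists S : {set I}, [&& S \subset T, S != set0, S != T
       & \dim (V + \sum_(j in S) W j)%VS == (\dim V + #|S|)%N]].
- have ltST : (#|S| < #|T|)%N by rewrite proper_card // properEneq nST.
  have [||v vS rkv] := IHk V S; first exact: leq_trans ltST leTk.
    by move=> U US; apply: rkW; exact: subset_trans US ST.
  pose V' := (V + \sum_(j in S) W j)%VS.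
  have cTS : (#|S| + #|T :\: S|)%N = #|T|.
    by rewrite -(cardsID S T) (setIidPr ST).
  have [||v' vT' rkv'] := IHk V' (T :\: S).
  + by apply: leq_trans leTk; rewrite -cTS -[ltnLHS]add0n ltn_add2r card_gt0.
  (* Tightness of [S] turns the hypothesis for the union of [S] and [U] into the one for [U]
     relative to [V']. *)
  + move=> U UTS; rewrite tightS -addnA.
    have dSU : [disjoint S & U].
      rewrite disjoint_sym; apply: disjointWl UTS _.
      by rewrite -setI_eq0 setDE -setIA (setIC _ S) setICr setI0.
    have <- : #|S :|: U| = (#|S| + #|U|)%N.
      by apply/eqP; rewrite (leq_card_setU S U).
    apply: leq_trans (rkW (S :|: U) _) _.
      by rewrite subUset ST (subset_trans UTS) ?subsetDl.
    by rewrite /V' -addvA (bigID (mem S)) /= dimvS // addvS // addvS //;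
       apply/subv_sumP => j; rewrite inE => /andP[jU jS];
       apply: (sumv_sup j) => //; move: jU jS; rewrite ?inE; case: (j \in S).
  exists (fun j => if j \in S then v j else v' j) => [j jT|].
    by case: ifP => jS; [exact: vS | apply: vT'; rewrite inE jS].
  (* The vectors chosen for [S] already fill [V'], by inclusion and dimension. *)
  have eqV' : (V + \sum_(j in S) <[v j]>)%VS = V'.
    apply/eqP; rewrite eqEdim tightS rkv andbT addvS //.
    apply/subv_sumP => j jS; apply: (sumv_sup j) => //.
    by rewrite -memvE vS.
  rewrite -cTS addnA -tightS (leq_trans rkv') // -/V' -eqV' -addvA dimvS //.
  rewrite addvS // subv_add; apply/andP; split; apply/subv_sumP => j jS.
    by apply: (sumv_sup j); [apply: (subsetP ST) | rewrite jS].
  move: jS; rewrite inE => /andP[/negPf jS jT].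
  by apply: (sumv_sup j); rewrite // jS.
have [w wW wV] : exists2 w, w \in W i & w \notin V.
  apply/subvPn/negP => WV; have := rkW [set i]%SET.
  rewrite sub1set => /(_ iT); rewrite cards1 big_set1 (addv_idPl WV).
  by rewrite addn1 ltnn.
have rkVw : \dim (V + <[w]>)%VS = (\dim V).+1.
  have := dimv_sum_cap V <[w]>.
  have -> : (V :&: <[w]> = 0)%VS.
    apply/eqP; rewrite -subv0; apply/subvP => u /memv_capP[uV /vlineP[c uc]].
    rewrite memv0 uc scaler_eq0; have [//|c0] := eqVneq c 0.
    by move: wV; rewrite -[w](scalerK c0) -uc memvZ.
  have w0 : w != 0 by apply: contraNneq wV => ->; rewrite mem0v.
  by rewrite dimv0 addn0 dim_vline w0 addn1.
have [||v vT' rkv] := IHk (V + <[w]>)%VS (T :\ i).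
- by apply: leq_trans leTk; rewrite (cardsD1 i T) iT.
- move=> S ST; rewrite rkVw addSn.
  have [->|S0] := eqVneq S set0.
    by rewrite cards0 addn0 -rkVw dimvS // addvSl.
  have ST' : S \subset T := subset_trans ST (subD1set _ _).
  have nST : S != T.
    by apply: contraTneq ST => ->; rewrite subsetD1 iT andbF.
  (* As [S] is not tight, its surplus of at least one pays for the dimension added by [w]. *)
  have := loose S; rewrite ST' S0 nST /= => nt.
  apply: (@leq_trans (\dim (V + \sum_(j in S) W j)%VS)); last first.
    by rewrite dimvS // addvS // addvSl.
  by rewrite ltn_neqAle eq_sym nt rkW.
exists (fun j => if j == i then w else v j) => [j jT|].
  by case: eqP => [->|/eqP ji] //; apply: vT'; rewrite !inE ji.
rewrite (cardsD1 i T) iT addnA addn1 -rkVw (leq_trans rkv) // dimvS //.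
rewrite -addvA addvS // subv_add; apply/andP; split.
  by apply: (sumv_sup i) => //; rewrite eqxx.
apply/subv_sumP => j; rewrite !inE => /andP[/negPf ji jT].
by apply: (sumv_sup j) => //; rewrite ji.
Qed.

(** The rows of [Q] form a basis of the annihilator of [V], obtained as the left kernel of a matrix
    whose columns are a basis of [V]. *)
Lemma vspace_kernel_mx n p (V : {vspace 'cV[K]_n}) : (\dim V + p)%N = n ->
  exists2 Q : 'M[K]_(p, n), row_free Q & forall v, (v \in V) = (Q *m v == 0).
Proof.
move=> dimV.
pose M : 'M[K]_(n, \dim V) := \matrix_(i, j) (vbasis V)`_j i 0.
have rkM : \rank M = \dim V.
  rewrite -mxrank_tr; apply/eqP/inj_row_free => c cM.
  have : \sum_(j < \dim V) c 0 j *: (vbasis V)`_j = 0.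
    apply/colP => i; rewrite summxE; have /rowP/(_ i) := cM.
    rewrite !mxE => cMi; rewrite -[RHS]cMi; apply: eq_bigr => j _.
    by rewrite !mxE.
  have /freeP fr := basis_free (vbasisP V); move/fr => c0.
  by apply/rowP => j; rewrite c0 mxE.
have rkK : \rank (kermx M) = p by rewrite mxrank_ker rkM -{1}dimV addKn.
pose Q := castmx (rkK, erefl n) (row_base (kermx M)).
have Qfree : row_free Q.
  by rewrite /Q; case: _ / rkK Q; rewrite castmx_id row_base_free.
have QM : Q *m M = 0.
  apply/sub_kermxP; rewrite /Q; case: _ / rkK Q Qfree => Q _.
  by rewrite castmx_id eq_row_base.
exists Q => // v.
have VQ : (V <= lker (linfun (mulmx Q : 'cV_n -> 'cV_p)))%VS.
  apply/subvP => u /coord_vbasis ->; apply: memv_suml => j _; apply: memvZ.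
  rewrite memv_ker lfunE /=; apply/eqP/colP => i.
  have /matrixP/(_ i j) := QM; rewrite [in LHS]mxE [RHS]mxE => QMi.
  rewrite !mxE -[RHS]QMi; apply: eq_bigr => l _; by rewrite [M _ _]mxE.
have /eqP -> : V == lker (linfun (mulmx Q : 'cV_n -> 'cV_p)).
  rewrite eqEdim VQ -(leq_add2r p) dimV.
  have := limg_ker_dim (linfun (mulmx Q : 'cV_n -> 'cV_p)) fullv.
  have -> : limg (linfun (mulmx Q : 'cV_n -> 'cV_p)) = fullv.
    apply/eqP; rewrite eqEsubv subvf /=; apply/subvP => y _.
    have /row_freeP[P QP] := Qfree.
    apply/memv_imgP; exists (P *m y); first exact: memvf.
    by rewrite lfunE /= mulmxA QP mul1mx.
  by rewrite capfv !dimvf /dim /= !muln1 => ->.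
by rewrite memv_ker lfunE.
Qed.

(** Adjoining to [U] the unit vectors outside [S], which add at most [p - #|S|] dimensions, gives
    the whole space. *)
Lemma dim_ge_deltas p (S : {set 'I_p}) (U : {vspace 'cV[K]_p}) :
  (forall j, j \in S -> delta_mx j 0%R \in U) -> (#|S| <= \dim U)%N.
Proof.
move=> SU; pose D := (\sum_(j in ~: S) <[delta_mx j 0%R : 'cV[K]_p]>)%VS.
have UD : (U + D)%VS = fullv.
  apply/eqP; rewrite eqEsubv subvf /=; apply/subvP => v _.
  rewrite (matrix_sum_delta v); apply: memv_suml => j _.
  rewrite big_ord1; apply: memvZ.
  have [jS|jS] := boolP (j \in S).
    by rewrite -[delta_mx _ _]addr0 memv_add ?mem0v // SU.
  rewrite -[delta_mx _ _]add0r memv_add ?mem0v // memvE.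
  by apply: (sumv_sup j); rewrite // inE.
have := dimv_sum_cap U D; rewrite UD dimvf /dim /= muln1.
have leD : (\dim D <= #|~: S|)%N.
  apply: leq_trans (dimv_leq_sum _ _ _) _.
  rewrite -sum1_card leq_sum // => j _; rewrite dim_vline; exact: leq_b1.
move=> dimE; rewrite -(leq_add2r #|~: S|) cardsC card_ord.
by rewrite (leq_trans (leq_addr (\dim (U :&: D)) _)) // dimE leq_add2l.
Qed.

End LinearAlgebra.

From mathcomp Require Import all_classical all_reals all_analysis.
Import numFieldNormedType.Exports.
Local Open Scope classical_set_scope.
Local Open Scope complex_scope.

(** * Linear differential equations on the half-line *)

Section Evolution.
Variable R : realType.
Implicit Types (e : R -> R) (t : R).

Lemma dnbhs_translate (a t : R) : (fun h : R => h + a) @ t^' --> (t + a)^'.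
Proof.
move=> A [r /= r0 tA]; exists r => // h /= th hNt; apply: tA => /=.
  by rewrite opprD addrACA subrr addr0.
by apply: contra hNt => /eqP/addIr ->.
Qed.

(** Passes between increments tending to 0, as in [is_derive], and quotients at [t], as in
    [has_evolution]. *)
Lemma is_derive1_quotient e t (l : R) :
  is_derive t 1 e l <->
  (s - t)^-1 * (e s - e t) @[s --> t^'] --> l.
Proof.
split=> [[de <-] | el].
- have := @dnbhs_translate (- t) t; rewrite subrr => sh.
  have := cvg_comp _ _ sh de; apply: cvg_trans.
  apply: near_eq_cvg; near=> s.
  by rewrite /= /GRing.scale /= mulr1 subrK.
- have sh : (fun h : R => h + t) @ 0^' --> t^'.
    by have := @dnbhs_translate t 0; rewrite add0r.
  have quot : h^-1 *: (e (h *: 1 + t) - e t) @[h --> 0^'] --> l.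
    have := cvg_comp _ _ sh el; apply: cvg_trans.
    apply: near_eq_cvg; near=> h.
    by rewrite /= /GRing.scale /= mulr1 addrK.
  by split; [apply/cvg_ex; exists l | apply/cvg_lim].
Unshelve. all: by end_near. Qed.

Lemma at_right0_within : (0 : R)^'+ `=>` within [set s : R | 0 <= s] 0^'.
Proof.
move=> A nA.
have {}nA : \forall u \near (0 : R), u != 0 -> 0 <= u -> A u := nA.
change (\forall u \near (0 : R), 0 < u -> A u).
near=> u => u0.
have : u != 0 -> 0 <= u -> A u by near: u; exact: nA.
by apply; [rewrite gt_eqF | exact: ltW].
Unshelve. all: by end_near. Qed.

(** The function [e s * expR (- lambda * s)] has derivative zero at positive times and is
    right-continuous at 0, hence is constant by the mean value theorem. *)
Lemma mode_unique (lambda : R) e :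
  (forall t, 0 <= t -> (s - t)^-1 * (e s - e t)
     @[s --> within [set s : R | 0 <= s] t^'] --> lambda * e t) ->
  forall t, 0 <= t -> e t = e 0 * expR (lambda * t).
Proof.
move=> de t; rewrite le_eqVlt => /predU1P[<-|t0].
  by rewrite mulr0 expR0 mulr1.
have de_pos (s : R) : 0 < s -> is_derive s 1 e (lambda * e s).
  move=> s0; apply/is_derive1_quotient; apply: cvg_trans (de s (ltW s0)).
  apply: cvg_app => A sA.
  have {}sA : \forall u \near s, u != s -> 0 <= u -> A u := sA.
  change (\forall u \near s, u != s -> A u).
  near=> u => us; have : u != s -> 0 <= u -> A u by near: u; exact: sA.
  apply=> //; apply: ltW; near: u; exact: lt_nbhsr.
pose g (s : R) := e s * expR (- lambda * s).
have dg (s : R) : 0 < s -> is_derive s 1 g 0.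
  move=> s0; have ds := de_pos s s0.
  have dx : is_derive s 1 (fun u => expR (- lambda * u))
      (- lambda * expR (- lambda * s)).
    have dl : is_derive s 1 (fun u : R => - lambda * u) (- lambda).
      by apply: is_derive_eq; rewrite /GRing.scale /= mulr1.
    have := is_derive1_comp (is_derive_expR (- lambda * s)) dl.
    by rewrite mulrC.
  apply: is_derive_eq.
  by rewrite /GRing.scale /=; ring.
have cont_pos (s : R) : 0 < s -> {for s, continuous g}.
  move=> s0; apply/differentiable_continuous/derivable1_diffP.
  by case: (dg s s0).
(* Near 0 on the right, [e s] is [e 0] plus [s] times a convergent difference quotient. *)
have cont0 : g s @[s --> 0^'+] --> g 0.
  have e0 : e s @[s --> 0^'+] --> e 0.
    have q0 := de 0 (lexx 0).
    have {}q0 : s^-1 * (e s - e 0) @[s --> 0^'+] --> lambda * e 0.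
      apply: cvg_trans q0; under [in X in _ `=>` X]eq_fun do rewrite subr0.
      exact: cvg_app (@at_right0_within).
    have s0 : (s : R) @[s --> 0^'+] --> (0 : R).
      by apply: cvg_at_right_filter; exact: cvg_id.
    have lim_e : e 0 + s * (s^-1 * (e s - e 0)) @[s --> 0^'+] --> e 0.
      have := cvgD (cvg_cst (e 0)) (cvgM s0 q0).
      by rewrite mul0r addr0; exact.
    apply: cvg_trans lim_e; apply: near_eq_cvg; near=> s.
    by rewrite /= mulrA divff ?mul1r ?subrKC // gt_eqF.
  apply: cvgM e0 _; apply: cvg_at_right_filter.
  apply: (@continuous_comp _ _ _ (fun s => - lambda * s) (@expR R)).
    exact: mulrl_continuous.
  exact: continuous_expR.
have [s|| c _] := @MVT R g (fun=> 0) 0 t t0.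
- by rewrite in_itv /= => /andP[s0 _]; exact: dg.
- apply/continuous_within_itvP => //; split=> //.
    by move=> s; rewrite in_itv /= => /andP[s0 _]; exact: cont_pos.
  by apply: cvg_at_left_filter; exact: cont_pos.
rewrite mul0r /g mulr0 expR0 mulr1 => /subr0_eq <-.
by rewrite -mulrA -expRD mulNr addNr expR0 mulr1.
Unshelve. all: by end_near. Qed.
Lemma cvg_mulmx_quotient n q (M : 'M[R]_(q, n)) k (x dx : R -> 'cV[R]_n) t :
  has_evolution (tau := ContinuousTime) x dx -> 0 <= t ->
  (s - t)^-1 * ((M *m x s) k 0 - (M *m x t) k 0)
    @[s --> within [set s : R | 0 <= s] t^'] --> (M *m dx t) k 0.
Proof.
move=> evx t0.
have -> : (fun s => (s - t)^-1 * ((M *m x s) k 0 - (M *m x t) k 0)) =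
    (fun s => \sum_i M k i * ((s - t)^-1 * (x s i 0 - x t i 0))).
  apply/funext => s; rewrite !mxE -sumrB mulr_sumr.
  by apply: eq_bigr => i _; rewrite -mulrBr mulrCA.
rewrite mxE; apply: cvg_big => [|i _]; first exact: add_continuous.
by apply: cvgMr; exact: evx.
Qed.

Section LinearFlow.
Variables (n : nat) (A : 'M[R]_n).
Implicit Types (xi : 'cV[R]_n) (i : 'I_n).

(** Taylor coefficients of entry [i] of exp(tA) xi; working entrywise brings in the theory of scalar
    power series. *)
Definition flow_coef xi i (j : nat) : R :=
  iter j (mulmx A) xi i 0 / j`!%:R.

Definition linear_flow xi t : 'cV[R]_n :=
  \col_i limn (pseries (flow_coef xi i) t).

(** The sum of all entries of [A] in absolute value bounds every row sum; the flow is thus dominated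
    by an exponential series. *)
Lemma iter_mulmx_bound xi i j :
  `|iter j (mulmx A) xi i 0| <=
    (\sum_k `|xi k 0|) * (\sum_k \sum_l `|A k l|) ^+ j.
Proof.
set c := \sum_k `|xi k 0|; set M := \sum_k \sum_l `|A k l|.
have le_sum (m : nat) (f : 'I_m -> R) k : (forall l, 0 <= f l) -> f k <= \sum_l f l.
  by move=> f0; rewrite (bigD1 k) //= lerDl sumr_ge0.
have c0 : 0 <= c by rewrite sumr_ge0.
have M0 : 0 <= M by rewrite sumr_ge0 // => k _; rewrite sumr_ge0.
elim: j i => [|j IHj] i /=.
  by rewrite expr0 mulr1; exact: (le_sum _ (fun k => `|xi k 0|)).
rewrite mxE exprS mulrCA (le_trans (ler_norm_sum _ _ _)) //.
apply: (@le_trans _ _ ((\sum_l `|A i l|) * (c * M ^+ j))).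
  rewrite mulr_suml ler_sum // => k _; rewrite normrM ler_wpM2l //.
apply: ler_wpM2r; first by rewrite mulr_ge0 // exprn_ge0.
by apply: (le_sum _ (fun k => \sum_l `|A k l|)) => k; rewrite sumr_ge0.
Qed.

Lemma is_cvg_flow xi i t : cvgn (pseries (flow_coef xi i) t).
Proof.
set c := \sum_k `|xi k 0|; set M := \sum_k \sum_l `|A k l|.
have c0 : 0 <= c by rewrite sumr_ge0.
pose v := c *: exp_coeff (M * `|t|).
have vE j : v j = c * ((M * `|t|) ^+ j / j`!%:R) by [].
rewrite /pseries; apply: normed_cvg; apply: (@series_le_cvg _ _ v) => [j|j|j|].
- exact: normr_ge0.
- rewrite vE mulr_ge0 // divr_ge0 ?ler0n // exprn_ge0 // mulr_ge0 //.
  by rewrite sumr_ge0 // => k _; rewrite sumr_ge0.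
- rewrite vE /flow_coef /= normrM normf_div normrX normr_nat exprMn.
  rewrite mulrAC !mulrA ler_wpM2r ?invr_ge0 ?ler0n //.
  by rewrite ler_wpM2r ?exprn_ge0 // iter_mulmx_bound.
- exact/is_cvg_seriesZ/is_cvg_series_exp_coeff.
Qed.

Lemma flow_coef_diffs xi i :
  pseries_diffs (flow_coef xi i) = flow_coef (A *m xi) i.
Proof.
apply/funext => j; rewrite /pseries_diffs /flow_coef iterSr factS natrM.
by rewrite invfM mulrCA mulVKf // pnatr_eq0.
Qed.

Lemma is_derive_linear_flow xi i t :
  is_derive t 1 (fun s => linear_flow xi s i 0) ((A *m linear_flow xi t) i 0).
Proof.
have -> : (fun s => linear_flow xi s i 0) =
    (fun s => limn (pseries (flow_coef xi i) s)).
  by apply/funext => s; rewrite mxE.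
have -> : (A *m linear_flow xi t) i 0 =
    limn (pseries (pseries_diffs (flow_coef xi i)) t).
  rewrite flow_coef_diffs mxE; apply/esym/cvg_lim => //.
  have -> : pseries (flow_coef (A *m xi) i) t =
      (fun N => \sum_k A i k * pseries (flow_coef xi k) t N).
    apply/funext => N; rewrite /pseries /series /=.
    under [RHS]eq_bigr do rewrite mulr_sumr.
    rewrite exchange_big /=; apply: eq_bigr => j _.
    rewrite /flow_coef -iterSr /= mxE !mulr_suml; apply: eq_bigr => k _.
    by rewrite !mulrA.
  apply: cvg_big => [|k _]; first exact: add_continuous.
  by rewrite mxE; apply: cvgMr; exact: is_cvg_flow.
(* Term-by-term differentiation at [t] asks for convergence at a point of larger modulus. *)
by apply: (@pseries_snd_diffs _ _ (`|t| + 1)); rewrite ?flow_coef_diffs;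
  [exact: is_cvg_flow .. | rewrite [ltRHS]ger0_norm ?addr_ge0 // ltrDl].
Qed.

Lemma linear_flow0 xi : linear_flow xi 0 = xi.
Proof.
apply/colP => i; rewrite mxE; apply/cvg_lim => //.
rewrite -cvg_shiftS; apply: cvg_near_cst; near=> N.
rewrite /pseries /series /= big_nat_recl // big1 => [|j _].
  by rewrite expr0 /flow_coef /= fact0 divr1 mulr1 addr0.
by rewrite expr0n mulr0.
Unshelve. all: by end_near. Qed.

End LinearFlow.

(** The tracking condition quantifies over trajectories; extracting algebra from it needs one that
    starts at each [xi]. *)
Lemma evolution_exists tau n (A : 'M[R]_n) (xi : 'cV[R]_n) :
  exists2 x : time R tau -> 'cV[R]_n,
    x (time0 R tau) = xi & has_evolution x (fun t : time R tau => A *m x t).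
Proof.
case: tau => /=.
  exists (linear_flow A xi) => [|t _ i]; first exact: linear_flow0.
  apply: cvg_within_filter; apply/is_derive1_quotient.
  exact: is_derive_linear_flow.
by exists (fun j : nat => iter j (mulmx A) xi).
Qed.

End Evolution.

(** * Complex spectra of real matrices *)

Lemma eigenvalue_trmx (K : fieldType) n (M : 'M[K]_n) z :
  eigenvalue M^T z = eigenvalue M z.
Proof.
rewrite /eigenvalue /eigenspace !kermx_eq0 !row_free_unit -[in LHS]unitmx_tr.
by rewrite linearB /= trmxK tr_scalar_mx.
Qed.

Lemma col_eigenvalueP (K : fieldType) n (M : 'M[K]_n) z :
  reflect (exists2 w : 'cV_n, M *m w = z *: w & w != 0) (eigenvalue M z).
Proof.
apply: (iffP idP) => [|[w Mw w0]].
  rewrite -eigenvalue_trmx => /eigenvalueP[w Mw w0].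
  exists w^T; last by rewrite trmx_eq0.
  by apply: trmx_inj; rewrite trmx_mul linearZ /= trmxK.
rewrite -eigenvalue_trmx; apply/eigenvalueP.
by exists w^T; rewrite ?trmx_eq0 // -trmx_mul Mw linearZ.
Qed.

Lemma eq_mulmx_col (K : pzRingType) k n (M N : 'M[K]_(k, n)) :
  (forall x : 'cV_n, M *m x = N *m x) -> M = N.
Proof.
move=> MN; apply/matrixP => i j; have /colP/(_ i) := MN (delta_mx j 0).
by rewrite -!colE !mxE.
Qed.

Section Spectra.
Variable R : realType.

Lemma map_Re_mulmx k n (M : 'M[R]_(k, n)) (w : 'cV[R[i]]_n) :
  map_mx (@complex.Re R) (mxC M *m w) = M *m map_mx (@complex.Re R) w.
Proof.
apply/colP => i; rewrite !mxE.
have ReD : {morph @complex.Re R : x y / x + y} by case=> ? ? [].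
rewrite (big_morph _ ReD (erefl _)); apply: eq_bigr => j _; rewrite !mxE.
by case: (w j 0) => a b /=; rewrite mul0r subr0.
Qed.

Lemma map_Im_mulmx k n (M : 'M[R]_(k, n)) (w : 'cV[R[i]]_n) :
  map_mx (@complex.Im R) (mxC M *m w) = M *m map_mx (@complex.Im R) w.
Proof.
apply/colP => i; rewrite !mxE.
have ImD : {morph @complex.Im R : x y / x + y} by case=> ? ? [].
rewrite (big_morph _ ImD (erefl _)); apply: eq_bigr => j _; rewrite !mxE.
by case: (w j 0) => a b /=; rewrite mul0r addr0.
Qed.

Lemma mx_ReIm_inj n (w w' : 'cV[R[i]]_n) :
  map_mx (@complex.Re R) w = map_mx (@complex.Re R) w' ->
  map_mx (@complex.Im R) w = map_mx (@complex.Im R) w' -> w = w'.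
Proof.
move=> /colP re /colP im; apply/colP => i; move: (re i) (im i); rewrite !mxE.
by case: (w i 0) (w' i 0) => a b [c d] /= -> ->.
Qed.

(** [Phi] turns [M] into a diagonal map. An eigenvector with a nonzero coordinate under [Phi] has
    its eigenvalue among the [lam j]; one killed by [Phi] lies in the complexification of [U], where
    [M] and [M'] agree. *)
Lemma eigenvalue_on_quotient n q (M M' : 'M[R]_n) (U V : {vspace 'cV[R]_n})
    (Phi : 'M[R]_(q, n)) (lam : 'I_q -> R) (z : R[i]) :
  (forall x, x \in V ->
     forall j, (Phi *m (M *m x)) j 0 = lam j * (Phi *m x) j 0) ->
  (forall x, x \in V -> Phi *m x = 0 -> x \in U) ->
  (forall x, x \in U -> M *m x = M' *m x) ->
  eigenvalue_on M V z ->
  (exists j, z = (lam j)%:C) \/ eigenvalue_on M' U z.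
Proof.
move=> PhiM kerPhi MM' [w [w0]].
set a := map_mx _ w; set b := map_mx _ w => aV bV Mw.
have Ma : M *m a = complex.Re z *: a - complex.Im z *: b.
  rewrite -map_Re_mulmx Mw; apply/colP => i; rewrite !mxE.
  by case: (z) (w i 0) => ? ? [].
have Mb : M *m b = complex.Re z *: b + complex.Im z *: a.
  rewrite -map_Im_mulmx Mw; apply/colP => i; rewrite !mxE.
  by case: (z) (w i 0) => ? ? [].
have [/andP[/eqP Pa /eqP Pb]|] := boolP ((Phi *m a == 0) && (Phi *m b == 0)).
  have [aU bU] : a \in U /\ b \in U by split; apply: kerPhi.
  right; exists w; split=> //.
  rewrite -Mw; apply: mx_ReIm_inj; rewrite ?map_Re_mulmx ?map_Im_mulmx.
    by rewrite MM'.
  by rewrite MM'.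
move=> Pab; left.
have [j Pj] : exists j, (Phi *m a) j 0 ^+ 2 + (Phi *m b) j 0 ^+ 2 != 0.
  apply/existsP; apply: contraNT Pab; rewrite negb_exists => /forallP P0.
  have PP j : ((Phi *m a) j 0 == 0) && ((Phi *m b) j 0 == 0).
    have := P0 j; rewrite negbK paddr_eq0 ?sqr_ge0 //.
    by rewrite !expf_eq0.
  apply/andP; split; apply/eqP/colP => j; have /andP[/eqP Pa /eqP Pb] := PP j;
    by rewrite [RHS]mxE.
exists j; have := PhiM _ aV j; have := PhiM _ bV j.
rewrite Ma Mb mulmxBr mulmxDr -!scalemxAr.
move: (Phi *m a) (Phi *m b) Pj => Pa Pb; rewrite !mxE.
set al := Pa j 0; set be := Pb j 0.
case: z {Mw Ma Mb} => x y /= albe eb ea.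
(* With c = al + i be, the identity (z - lam j) c = 0 is multiplied by the conjugate of c and split
   into real and imaginary parts. *)
have xl : x = lam j.
  apply/eqP; rewrite -subr_eq0.
  suff : (x - lam j) * (al ^+ 2 + be ^+ 2) == 0 by rewrite mulf_eq0 (negPf albe) orbF.
  have e1 : (x - lam j) * al = y * be by move: ea; lra.
  have e2 : (x - lam j) * be = - (y * al) by move: eb; lra.
  by apply/eqP; rewrite mulrDr !expr2 !mulrA e1 e2; ring.
have y0 : y = 0.
  apply/eqP; suff : y * (al ^+ 2 + be ^+ 2) == 0.
    by rewrite mulf_eq0 (negPf albe) orbF.
  have e1 : y * be = 0 by move: ea; rewrite xl; lra.
  have e2 : y * al = 0 by move: eb; rewrite xl; lra.
  by rewrite mulrDr !expr2 !mulrA e1 e2 !mul0r addr0.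
by rewrite xl y0.
Qed.

Lemma stable_matrixP tau n (M : 'M[R]_n) :
  stable_matrix tau M <->
  forall z, eigenvalue_on M fullv z -> Cgood tau z.
Proof.
split=> stM z; last by move=> /col_eigenvalueP[w Mw w0]; apply: stM;
  exists w; rewrite !memvf.
by move=> [w [w0 _ _ Mw]]; apply/stM/col_eigenvalueP; exists w.
Qed.

(** The numbers -1, -2, ..., respectively 1/2, 1/3, ..., are infinitely many stable reals. *)
Lemma stable_real_exists tau (X : set R[i]) : finite_set X ->
  exists2 mu : R, Cgood tau mu%:C & ~ X mu%:C.
Proof.
move=> finX.
pose f (j : nat) : R := if tau is ContinuousTime then - j.+1%:R else j.+2%:R^-1.
have f_inj : injective (fun j => (f j)%:C).
  move=> j k [] /eqP; rewrite /f; case: tau f => _.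
    by rewrite eqr_opp eqr_nat => /eqP[].
  by rewrite (inj_eq GRing.invr_inj) eqr_nat => /eqP[].
have f_good j : Cgood tau (f j)%:C.
  rewrite /f; case: tau f f_inj => _ _ /=; first by rewrite oppr_lt0 ltr0n.
  have -> : `|(j.+2%:R^-1)%:C| = (j.+2%:R^-1 : R)%:C.
    by rewrite ger0_norm // lecR invr_ge0 ler0n.
  by rewrite (@ltcR R _ 1) invf_lt1 ?ltr0n // ltr1n.
apply: contrapT => nogood; apply: infinite_nat.
apply: sub_finite_set (finite_preimage (f := fun j => (f j)%:C) _ finX).
  move=> j _; apply: contrapT => nX; apply: nogood; exists (f j) => //.
by move=> j k _ _; exact: f_inj.
Qed.

Lemma finite_eigenvalues n (M : 'M[R]_n) :
  finite_set [set z | eigenvalue (mxC M) z].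
Proof.
have [r defM] := closed_field_poly_normal (char_poly (mxC M)).
apply: (@sub_finite_set _ _ [set` r]); last exact: finite_seq.
move=> z /=; rewrite eigenvalue_root_char defM rootZ ?root_prod_XsubC //.
by rewrite lead_coef_eq0 monic_neq0 // char_poly_monic.
Qed.

End Spectra.

(** * The system pencil and the algebraic form of the tracking problem *)

Section System.
Variables (R : realType) (n m p : nat) (Sigma : lti_system R n m p).
Implicit Types (F : 'M[R]_(m, n)) (lambda : 'I_p -> R) (mu : R).

Lemma normal_rank_right_invertible :
  right_invertible Sigma -> normal_rank Sigma = (n + p)%N.
Proof.
move=> rinv; apply/eqP; rewrite eqn_leq; apply/andP; split.
  by apply/bigmax_leqP => r _; rewrite -ltnS.
have [mu _ good] := stable_real_exists ContinuousTime rinv.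
apply: (@leq_bigmax_cond _ _ _ (@ord_max (n + p))).
by apply/asboolP; exists mu%:C; apply: contrapT.
Qed.

Lemma rank_rosenbrock z : right_invertible Sigma ->
  ~ invariant_zeros Sigma z -> \rank (rosenbrock Sigma z) = (n + p)%N.
Proof.
move=> rinv nz; apply/eqP; rewrite eqn_leq rank_leq_row leqNgt.
by apply/negP => lt_rk; apply: nz; rewrite /invariant_zeros /= normal_rank_right_invertible.
Qed.

(** Rank is unchanged by field extension, so the real pencil has a right inverse; the feedback is
    absorbed by the change of input from [w] to [w - F v]. *)
Lemma rosenbrock_solvable F mu (f : 'cV[R]_n) (g : 'cV[R]_p) :
  \rank (rosenbrock Sigma mu%:C) = (n + p)%N ->
  exists v w,
    closed_loop Sigma F *m v - mu *: v + sysB Sigma *m w = f /\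
    error_map Sigma F *m v + sysD Sigma *m w = g.
Proof.
set P := block_mx (sysA Sigma - mu%:M) (sysB Sigma) (sysC Sigma) (sysD Sigma).
have -> : rosenbrock Sigma mu%:C = map_mx (real_complex R) P.
  by rewrite map_block_mx map_mxB map_scalar_mx.
rewrite mxrank_map => rkP.
have /row_freeP[P' PP'] : row_free P by rewrite /row_free rkP.
have := mulmxA P P' (col_mx f g); rewrite PP' mul1mx.
set x := P' *m _; rewrite -[x]vsubmxK mul_block_col => /eq_col_mx[Pf Pg].
exists (usubmx x), (dsubmx x - F *m usubmx x); rewrite /closed_loop /error_map.
split; rewrite mulmxDl mulmxBr -!mulmxA.
  rewrite -Pf mulmxBl mul_scalar_mx; set b := sysB Sigma *m (F *m _).
  by rewrite (addrAC _ b) -[LHS]addrA (addrC b) subrK.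
by rewrite -Pg -[LHS]addrA (addrC (_ *m (F *m _))) subrK.
Qed.

Lemma mem_Rstar_row (j : 'I_p) mu (v : 'cV[R]_n) :
  v \in Rstar Sigma j mu <->
  exists w, sysA Sigma *m v + sysB Sigma *m w = mu *: v /\
    forall k, k != j -> (sysC Sigma *m v + sysD Sigma *m w) k 0 = 0.
Proof.
have row'M q (M : 'M[R]_(p, q)) (x : 'cV_q) i :
    (row' j M *m x) i 0 = (M *m x) (lift j i) 0.
  by rewrite !mxE; apply: eq_bigr => l _; rewrite mxE.
rewrite mem_Rstar; split=> -[w].
  rewrite mul_block_col mulmxBl mul_scalar_mx -[0]vsubmxK linear0 linear0.
  move=> /eq_col_mx[/eqP]; rewrite addrAC subr_eq0 => /eqP Aw Cw.
  exists w; split=> // k kj; have jk : j != k by rewrite eq_sym.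
  have [i -> _] := unlift_some jk.
  by have /colP/(_ i) := Cw; rewrite mxE !row'M !mxE.
move=> [Aw Cw]; exists w.
rewrite mul_block_col mulmxBl mul_scalar_mx addrAC Aw subrr -[RHS]vsubmxK.
rewrite !linear0; congr col_mx; apply/colP => i.
have := Cw (lift j i); rewrite eq_sym neq_lift => /(_ isT) Ci.
by rewrite mxE !row'M [RHS]mxE -[RHS]Ci [RHS]mxE.
Qed.

(** Forwards, the prescribed error is compared at times 0 and 1 in discrete time, and through its
    derivative at 0 in continuous time. Backwards, each error component obeys a scalar first-order
    equation, and [beta] is the initial error. *)
Lemma solves_single_modeP tau lambda F :
  solves_single_mode_problem tau Sigma lambda F <->
  stable_matrix tau (closed_loop Sigma F) /\
  forall (xi : 'cV[R]_n) k,
    (error_map Sigma F *m (closed_loop Sigma F *m xi)) k 0 =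
    lambda k * (error_map Sigma F *m xi) k 0.
Proof.
split=> -[stF modes]; split=> //.
- case: modes => beta modes xi k.
  have [x x0 dx] := evolution_exists tau (closed_loop Sigma F) xi.
  have errE t : in_time t -> (error_map Sigma F *m x t) k 0 =
      beta xi k * mode (lambda k) t.
    move=> tt; have := modes 0 0 0 x (fun t => F *m x t) _ _ _ t tt k.
    rewrite x0 !subr0 => <-; rewrite /error_map ?mulmxDl ?mulmxA //.
    + by rewrite /steady_state !mulmx0 !addr0; case: (tau).
    + by move=> s; rewrite subr0 addr0.
    + have -> // : (fun s => sysA Sigma *m x s + sysB Sigma *m (F *m x s)) =
          (fun s => closed_loop Sigma F *m x s).
      by apply/funext => s; rewrite mulmxDl mulmxA.
  case: tau x x0 dx errE stF modes => /= x x0 dx errE _ _; last first.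
    have := errE 0%N I; have := errE 1%N I.
    by rewrite dx x0 expr0 expr1 mulr1 => -> ->; rewrite mulrC.
  have bE : (error_map Sigma F *m xi) k 0 = beta xi k.
    by have := errE 0 (lexx 0); rewrite mulr0 expR0 mulr1 x0.
  have := @cvg_mulmx_quotient R n p (error_map Sigma F) k x _ 0 dx (lexx 0).
  move=> /(cvg_trans (cvg_app _ (@at_right0_within R))); rewrite x0.
  (* The right difference quotient of the error at 0 has one limit by the state equation and another
     by the assumed mode; the two must agree. *)
  set q := (X in nbhs X) => lim1.
  have dmode : is_derive (0 : R) 1
      (fun s => beta xi k * expR (lambda k * s)) (lambda k * beta xi k).
    have dl : is_derive (0 : R) 1 (fun s => lambda k * s) (lambda k).
      by apply: is_derive_eq; rewrite /GRing.scale /= mulr1.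
    have de := is_derive1_comp (is_derive_expR (lambda k * 0)) dl.
    apply: is_derive_eq; rewrite mulr0 expR0 mul1r /GRing.scale /= mulrC.
    by [].
  move/is_derive1_quotient: dmode => /cvg_dnbhs_at_right lim2.
  have <- := cvg_lim (@norm_hausdorff _ _) lim1.
  transitivity (lambda k * beta xi k); last by rewrite -bE.
  apply: cvg_lim => //; apply: cvg_trans lim2; apply: near_eq_cvg; near=> s.
  have s0 : 0 <= s by apply: ltW; near: s; exact: nbhs_right_gt.
  have -> := errE s s0; congr (_ * (_ - _)).
  by rewrite bE mulr0 expR0 mulr1.
- exists (fun xi k => (error_map Sigma F *m xi) k 0).
  move=> r xss uss x u [ssx ssr] uE dx t tt k.
  pose xi s := x s - xss.
  have errE s : sysC Sigma *m x s + sysD Sigma *m u s - r = error_map Sigma F *m xi s.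
    rewrite uE -ssr /error_map mulmxDl (mulmxBr (sysC Sigma)) mulmxDr -mulmxA opprD.
    rewrite (addrA _ _ (sysD Sigma *m uss)).
    by rewrite addrACA subrr addr0 addrAC.
  rewrite errE.
  have rhsE s : sysA Sigma *m x s + sysB Sigma *m u s =
     closed_loop Sigma F *m xi s + match tau with ContinuousTime => 0 | DiscreteTime => xss end.
    rewrite uE -ssx /closed_loop mulmxDl (mulmxBr (sysA Sigma)) mulmxDr -mulmxA.
    by rewrite [in RHS]addrAC [in RHS]addrA subrK addrA addrAC.
  case: tau x u t tt {stF} dx ssx uE @xi errE rhsE => /= x u t tt dx _ _ errE rhsE.
    pose xi s := x s - xss; pose e (s : R) : R := (error_map Sigma F *m xi s) k 0.
    suff ev_e : forall s, 0 <= s -> (v - s)^-1 * (e v - e s)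
        @[v --> within [set v : R | 0 <= v] s^'] --> lambda k * e s.
      exact: (mode_unique ev_e).
    move=> s s0.
    have dxi : has_evolution (tau := ContinuousTime) xi
        (fun s => closed_loop Sigma F *m xi s).
      move=> v v0 i; have := dx v v0 i; rewrite rhsE addr0.
      apply: cvg_trans; apply: near_eq_cvg; near=> y.
      by rewrite /xi !mxE; congr (_ * _); rewrite opprB addrA subrK.
    by have := @cvg_mulmx_quotient R n p (error_map Sigma F) k xi _ s dxi s0; rewrite modes.
  elim: t {tt} => [|t IHt]; first by rewrite expr0 mulr1.
  by rewrite dx rhsE addrK modes IHt exprS mulrCA.
Unshelve. all: by end_near. Qed.

End System.

(** * Necessity: directions forced by a solution *)

Section ModalDirections.
Variables (R : realType) (tau : time_domain) (n m p : nat).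
Variables (Sigma : lti_system R n m p) (Vg : {vspace 'cV[R]_n}).
Hypothesis Vg_largest : is_Vgstar tau Sigma Vg.
Implicit Types (F : 'M[R]_(m, n)) (mu : R).

(** The kernel of the error map is invariant, output nulling and stable, hence inside [Vg]. It has
    dimension at least [n - p], so both inclusion and rank bound are equalities. *)
Lemma Vgstar_eq_ker_error F (lambda : 'I_p -> R) :
  (\dim Vg + p)%N = n ->
  stable_matrix tau (closed_loop Sigma F) ->
  error_map Sigma F *m closed_loop Sigma F =
    diag_mx (\row_k lambda k) *m error_map Sigma F ->
  (forall v, (v \in Vg) = (error_map Sigma F *m v == 0)) /\
  (forall g : 'cV_p, exists v, error_map Sigma F *m v = g).
Proof.
move=> dimVg stF EA; set E := error_map Sigma F in EA *.
pose f := linfun (@mulmx R p n 1 E).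
have memf v : (v \in lker f) = (E *m v == 0) by rewrite memv_ker lfunE.
have kerVg : (lker f <= Vg)%VS.
  apply: (proj2 Vg_largest); exists F; split=> [v|v|z].
  - by rewrite !memf => /eqP Ev; rewrite mulmxA EA -mulmxA Ev mulmx0.
  - by rewrite memf => /eqP.
  - move=> [w [w0 _ _ Mw]]; apply: stF; apply/col_eigenvalueP.
    by exists w.
have := limg_ker_dim f fullv; rewrite capfv dimvf /dim /= muln1 => dimf.
have dim_img : (\dim (limg f) <= p)%N.
  by apply: leq_trans (dimvS (subvf _)) _; rewrite dimvf /dim /= muln1.
have dim_ker := dimvS kerVg.
have eq_dim : \dim (lker f) = \dim Vg.
  apply/eqP; rewrite eqn_leq dim_ker /= -(leq_add2r p) dimVg -{1}dimf.
  by rewrite leq_add2l.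
split=> [v | g].
  suff /eqP <- : lker f == Vg by exact: memf.
  by rewrite eqEdim kerVg eq_dim leqnn.
have : g \in limg f.
  suff /eqP -> : limg f == fullv by rewrite memvf.
  rewrite eqEdim subvf dimvf /dim /= muln1.
  by rewrite -(leq_add2l (\dim (lker f))) dimf eq_dim dimVg.
by move=> /memv_imgP[v _ ->]; exists v; rewrite lfunE.
Qed.

(* Otherwise [Vg + <[v]>] would be a larger output-nulling stable subspace. *)
Lemma Vgstar_absorbs_mode F mu (v : 'cV[R]_n) (w : 'cV[R]_m) :
  (forall x, (x \in Vg) = (error_map Sigma F *m x == 0)) ->
  (forall x, x \in Vg -> closed_loop Sigma F *m x \in Vg) ->
  stable_matrix tau (closed_loop Sigma F) -> Cgood tau mu%:C ->
  closed_loop Sigma F *m v + sysB Sigma *m w = mu *: v ->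
  error_map Sigma F *m v + sysD Sigma *m w = 0 ->
  v \in Vg.
Proof.
set A := closed_loop Sigma F; set E := error_map Sigma F.
move=> VgE VgA stA mu_good Av Ev; apply/negPn/negP => vVg.
have [j Evj] : exists j, (E *m v) j 0 != 0.
  apply/existsP; rewrite -[X in is_true X]negbK negb_exists.
  apply: contra vVg => /forallP E0; rewrite VgE; apply/eqP/colP => j.
  by have /eqP-> := negbNE (E0 j); rewrite mxE.
(* A functional vanishing on [Vg] and equal to 1 at [v]: adding [w *m phi] to [F] changes nothing on
   [Vg] and applies [w] along [v]. *)
pose phi : 'rV[R]_n := ((E *m v) j 0)^-1 *: row j E.
have phiVg x : x \in Vg -> phi *m x = 0.
  by rewrite VgE => /eqP Ex; rewrite -scalemxAl -row_mul Ex linear0 scaler0.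
have phiv : phi *m v = 1%:M.
  rewrite -scalemxAl -row_mul; apply/matrixP => a b.
  by rewrite !ord1 !mxE mulVf //; move: Evj; rewrite mxE.
pose F1 := F + w *m phi.
have A1 : closed_loop Sigma F1 = A + sysB Sigma *m w *m phi.
  by rewrite /closed_loop mulmxDr addrA mulmxA.
have E1 : error_map Sigma F1 = E + sysD Sigma *m w *m phi.
  by rewrite /error_map mulmxDr addrA mulmxA.
have A1Vg x : x \in Vg -> closed_loop Sigma F1 *m x = A *m x.
  by move=> xV; rewrite A1 (mulmxDl A) -mulmxA phiVg // mulmx0 addr0.
have A1v : closed_loop Sigma F1 *m v = mu *: v.
  by rewrite A1 (mulmxDl A) -[_ *m phi *m v]mulmxA phiv mulmx1.
have E1v : error_map Sigma F1 *m v = 0.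
  by rewrite E1 (mulmxDl E) -[_ *m phi *m v]mulmxA phiv mulmx1.
suff Vgv : (Vg + <[v]> <= Vg)%VS.
  case/negP: vVg; apply: (subvP Vgv); apply: (subvP (addvSr _ _)).
  exact: memv_line.
apply: (proj2 Vg_largest); exists F1; split.
- move=> x /memv_addP[a aV [_ /vlineP[c ->] ->]].
  rewrite mulmxDr -scalemxAr A1v A1Vg // memv_add ?VgA //.
  by rewrite !memvZ // memv_line.
- move=> x /memv_addP[a aV [_ /vlineP[c ->] ->]].
  rewrite mulmxDr -scalemxAr E1v scaler0 addr0 E1 (mulmxDl E) -mulmxA phiVg //.
  by rewrite mulmx0 addr0; apply/eqP; rewrite -VgE.
(* The enlarged subspace adds only the eigenvalue [mu], read off by [phi]. *)
- move=> z eigz; have [||||] := @eigenvalue_on_quotient _ _ 1 _ A Vg _ phi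
    (fun=> mu) z _ _ _ eigz.
  + move=> x /memv_addP[a aV [_ /vlineP[c ->] ->]] i.
    rewrite !mulmxDr -!scalemxAr A1v A1Vg // phiVg ?VgA // phiVg //.
    by rewrite !add0r -scalemxAr !mxE mulrCA.
  + move=> x /memv_addP[a aV [_ /vlineP[c ->] ->]].
    rewrite mulmxDr -scalemxAr phiVg // add0r phiv => /matrixP/(_ 0 0).
    by rewrite !mxE mulr1 => ->; rewrite scale0r addr0.
  + exact: A1Vg.
  + by move=> [_ ->].
  + move=> [u [u0 _ _ Mu]]; apply/stA/col_eigenvalueP.
    by exists u.
Qed.

(** Solving the pencil at [lambda k] directly gives a vector of [Rstar] with E v + D w = e_k; the
    work lies in showing D w = 0. *)
Lemma modal_direction F (lambda : 'I_p -> R) (k : 'I_p) :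
  right_invertible Sigma -> (\dim Vg + p)%N = n ->
  stable_matrix tau (closed_loop Sigma F) ->
  error_map Sigma F *m closed_loop Sigma F =
    diag_mx (\row_k lambda k) *m error_map Sigma F ->
  ~ invariant_zeros Sigma (lambda k)%:C ->
  exists2 v, v \in Rstar Sigma k (lambda k) &
    error_map Sigma F *m v = delta_mx k 0.
Proof.
move=> rinv dimVg stF EA lk_not_zero.
have [VgE Esurj] := Vgstar_eq_ker_error dimVg stF EA.
set A := closed_loop Sigma F in stF EA *; set E := error_map Sigma F in EA VgE Esurj *.
set B := sysB Sigma; set D := sysD Sigma.
pose L mu : 'M[R]_p := diag_mx (\row_k lambda k) - mu%:M.
have EAmu mu v : E *m (A *m v - mu *: v) = L mu *m (E *m v).
  by rewrite mulmxBr (mulmxA E) EA -scalemxAr mulmxBl mul_scalar_mx mulmxA.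
pose G mu := E *m B - L mu *m D.
have GE mu w : G mu *m w = E *m (B *m w) - L mu *m (D *m w).
  by rewrite (mulmxBl (E *m B)) -!mulmxA.
(* Applying [E] to the state equation trades [A] for the diagonal matrix and relates the total error
   to [w] alone. *)
have Gker mu (v : 'cV_n) (w : 'cV_m) : A *m v - mu *: v + B *m w = 0 ->
    L mu *m (E *m v + D *m w) = - (G mu *m w).
  move=> /(congr1 (mulmx E)); rewrite mulmxDr EAmu mulmx0 => /eqP.
  rewrite addr_eq0 => /eqP eqL.
  by rewrite mulmxDr eqL GE opprB addrC.
have Gsurj mu : \rank (rosenbrock Sigma mu%:C) = (n + p)%N ->
    \dim (lker (linfun (@mulmx R p m 1 (G mu)))) = (m - p)%N.
  move=> rk; set g := linfun _.
  suff dimG : (\dim (lker g) + p)%N = m by rewrite -[in RHS]dimG addnK.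
  have := limg_ker_dim g fullv; rewrite capfv dimvf /dim /= muln1 => dimG.
  rewrite -[in RHS]dimG; congr (_ + _)%N; suff -> : limg g = fullv by rewrite dimvf /dim /= muln1.
  apply/eqP; rewrite eqEsubv subvf /=; apply/subvP => y _.
  have [f Ef] := Esurj y.
  have [v [w [Avw Evw]]] := rosenbrock_solvable F f 0 rk.
  apply/memv_imgP; exists w; rewrite ?memvf // lfunE /= GE -Ef -Avw.
  rewrite mulmxDr EAmu [RHS]addrC; congr (_ + _).
  by rewrite -mulmxN; congr (_ *m _); apply/eqP; rewrite -addr_eq0 Evw.
have [|mu mu_good] := @stable_real_exists R tau
    ([set z | \rank (rosenbrock Sigma z) <> (n + p)%N] `|`
     [set z | eigenvalue (mxC A) z]).
  by rewrite finite_setU; split; [exact: rinv | exact: finite_eigenvalues].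
move=> /not_orP[/= /contrapT rk_mu]; rewrite eigenvalue_map => /negP mu_neig.
(* Each [lambda j] is an eigenvalue of [A], with left eigenvector the nonzero row [j] of [E]; so
   [mu] differs from all of them. *)
have Lmu_unit : L mu \in unitmx.
  rewrite -row_free_unit; apply: inj_row_free => y.
  rewrite mulmxBr mul_mx_diag mul_mx_scalar => /rowP yL; apply/rowP => j.
  have := yL j; rewrite !mxE (mulrC mu) -mulrBr => /eqP.
  rewrite mulf_eq0 subr_eq0 => /orP[/eqP // | /eqP lj].
  case/negP: mu_neig; apply/eigenvalueP; exists (row j E).
    by rewrite -row_mul EA row_mul row_diag_mx -scalemxAl -rowE mxE lj.
  have [v Ev] := Esurj (delta_mx j 0).
  apply: contra_eq_neq (row_mul j E v) => ->.
  rewrite mul0mx Ev; apply/negP => /eqP/matrixP/(_ 0 0)/eqP.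
  by rewrite !mxE !eqxx oner_eq0.
have Amu_unit : A - mu%:M \in unitmx.
  by rewrite -row_free_unit -kermx_eq0; move: mu_neig; rewrite negbK.
have kerGmu (w : 'cV_m) : G mu *m w = 0 -> D *m w = 0 /\ E *m (B *m w) = 0.
  move=> Gw; pose v : 'cV_n := - (invmx (A - mu%:M) *m (B *m w)).
  have Av : A *m v - mu *: v + B *m w = 0.
    by rewrite -mul_scalar_mx -mulmxBl mulmxN mulKVmx // addNr.
  have Ev : E *m v + D *m w = 0.
    apply: (can_inj (mulKmx Lmu_unit)).
    by rewrite Gker // Gw oppr0 mulmx0.
  have : v \in Vg.
    apply: (@Vgstar_absorbs_mode F mu v w) => //.
      by move=> x; rewrite !VgE => /eqP Ex; rewrite mulmxA EA -mulmxA Ex mulmx0.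
    by move/eqP: Av; rewrite addrAC subr_eq0 => /eqP.
  rewrite VgE => /eqP Ev0; move: Ev; rewrite Ev0 add0r => Dw; split=> //.
  by move: Gw; rewrite GE Dw mulmx0 subr0.
(* Inputs with D w = 0 and E B w = 0 are killed by every [G], which gives one inclusion; both
   kernels have dimension [m - p]. *)
have kerG_eq : lker (linfun (@mulmx R p m 1 (G mu))) =
    lker (linfun (@mulmx R p m 1 (G (lambda k)))).
  apply/eqP; rewrite eqEdim !Gsurj ?leqnn ?andbT //; last exact: rank_rosenbrock.
  apply/subvP => w; rewrite !memv_ker !lfunE /= => /eqP/kerGmu[Dw EBw].
  by rewrite GE EBw Dw mulmx0 subrr.
have [v [w [Avw Evw]]] := rosenbrock_solvable F 0 (delta_mx k 0)
  (rank_rosenbrock rinv lk_not_zero).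
(* The unit vector e_k is in the kernel of [L (lambda k)]. *)
have Gw : G (lambda k) *m w = 0.
  apply/eqP; rewrite -oppr_eq0 -(Gker (lambda k) v) // Evw mulmxBl mul_scalar_mx mul_diag_mx.
  apply/eqP/colP => j; rewrite !mxE.
  by have [->|] := eqVneq j k; rewrite ?subrr // !mulr0 subrr.
have [Dw _] : D *m w = 0 /\ E *m (B *m w) = 0.
  apply: kerGmu; apply/eqP; have : w \in lker (linfun (@mulmx R p m 1 (G mu))).
    by rewrite kerG_eq memv_ker lfunE /= Gw.
  by rewrite memv_ker lfunE.
exists v; last by rewrite -Evw -/D Dw addr0.
apply/mem_Rstar_row; exists (F *m v + w); split.
  apply/eqP; rewrite -subr_eq0 -Avw; apply/eqP.
  rewrite /closed_loop mulmxDl mulmxDr -mulmxA.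
  by rewrite [in RHS]addrAC !addrA.
move=> j jk; have /colP/(_ j) := Evw.
rewrite /E /error_map mulmxDl mulmxDr -mulmxA addrA => ->.
by rewrite mxE (negPf jk).
Qed.

End ModalDirections.

(** * Sufficiency: construction of the feedback *)

Section Synthesis.
Variables (R : realType) (tau : time_domain) (n m p : nat).
Variables (Sigma : lti_system R n m p) (Vg : {vspace 'cV[R]_n}).
Variable lambda : 'I_p -> R.

(** [Phi] reads the coordinates along the [v j] modulo [Vg], where the closed loop acts diagonally.
    Since the mode [v j] excites only error row [j], the error map is a diagonal matrix times
    [Phi]. *)
Lemma synthesis (v : 'I_p -> 'cV[R]_n) :
  output_nulling_stable tau Sigma Vg -> (\dim Vg + p)%N = n ->
  (forall j, Cgood tau (lambda j)%:C) ->
  (forall j, v j \in Rstar Sigma j (lambda j)) ->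
  (Vg + \sum_j <[v j]>)%VS = fullv ->
  exists F, solves_single_mode_problem tau Sigma lambda F.
Proof.
move=> [F0 [invF0 errF0 stF0]] dimVg lam_good vR Vgv.
have /choice[w wP] : forall j, exists w,
    sysA Sigma *m v j + sysB Sigma *m w = lambda j *: v j /\
    forall k, k != j -> (sysC Sigma *m v j + sysD Sigma *m w) k 0 = 0.
  by move=> j; apply/mem_Rstar_row.
have [Q Qfree VgQ] := vspace_kernel_mx dimVg.
pose V : 'M[R]_(n, p) := \matrix_(i, j) v j i 0.
pose W : 'M[R]_(m, p) := \matrix_(i, j) w j i 0.
have colV j : col j V = v j by apply/colP => i; rewrite !mxE.
have colW j : col j W = w j by apply/colP => i; rewrite !mxE.
have colM k q (M : 'M[R]_(k, q)) N (j : 'I_p) : M *m col j N = col j (M *m N).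
  by rewrite !colE mulmxA.
(* A row [y] with y Q V = 0 makes [y *m Q] vanish on [Vg] and on every [v j], hence everywhere. *)
have QV_unit : Q *m V \in unitmx.
  rewrite -row_free_unit; apply: inj_row_free => y yQV.
  apply/eqP; rewrite -(mulmx_free_eq0 _ Qfree); apply/eqP/eq_mulmx_col => x.
  rewrite mul0mx; have : x \in (Vg + \sum_j <[v j]>)%VS by rewrite Vgv memvf.
  move=> /memv_addP[a aV [b /memv_sumP[c cv ->] ->]].
  rewrite mulmxDr -mulmxA; move: aV; rewrite VgQ => /eqP ->.
  rewrite mulmx0 add0r mulmx_sumr big1 // => j _.
  have /vlineP[e ->] := cv j isT.
  by rewrite -scalemxAr -colV colE !mulmxA -(mulmxA y) yQV mul0mx scaler0.
pose Phi := invmx (Q *m V) *m Q.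
have VgPhi x : (x \in Vg) = (Phi *m x == 0).
  rewrite VgQ -mulmxA; apply/eqP/eqP => [->|Qx]; first by rewrite mulmx0.
  by rewrite -[LHS](mulKVmx QV_unit) Qx mulmx0.
have PhiV : Phi *m V = 1%:M by rewrite -mulmxA mulVmx.
(* This equals [F0] on [Vg] and sends each [v j] to [w j]. *)
pose F := F0 + (W - F0 *m V) *m Phi.
have FVg x : x \in Vg -> F *m x = F0 *m x.
  by rewrite VgPhi => /eqP Px; rewrite mulmxDl -mulmxA Px mulmx0 addr0.
have FV : F *m V = W by rewrite mulmxDl -mulmxA PhiV mulmx1 subrKC.
have AVg x : x \in Vg -> closed_loop Sigma F *m x = closed_loop Sigma F0 *m x.
  by move=> xV; rewrite !mulmxDl -!mulmxA FVg.
have EVg x : x \in Vg -> error_map Sigma F *m x = 0.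
  by move=> xV; rewrite -(errF0 x xV) !mulmxDl -!mulmxA FVg.
pose L : 'M[R]_p := diag_mx (\row_k lambda k).
pose Gam := error_map Sigma F *m V.
have AV : closed_loop Sigma F *m V = V *m L.
  rewrite mulmxDl -mulmxA FV; apply/matrixP => i j.
  have /colP/(_ i) := (wP j).1; rewrite -colV -colW !colM mul_mx_diag.
  by rewrite !mxE mulrC.
(* [Gam] is diagonal, so it commutes with [L]. *)
have GamL : Gam *m L = L *m Gam.
  have GamE k j : Gam k j * lambda j = lambda k * Gam k j.
    have [->|kj] := eqVneq k j; first exact: mulrC.
    suff -> : Gam k j = 0 by rewrite mul0r mulr0.
    rewrite -((wP j).2 k kj) -colV -colW !colM /Gam mulmxDl -mulmxA FV.
    by rewrite !mxE.
  rewrite mul_mx_diag mul_diag_mx; move: Gam GamE => G GE.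
  by apply/matrixP => k j; rewrite !mxE GE.
have splitV (x : 'cV_n) : x - V *m (Phi *m x) \in Vg.
  by rewrite VgPhi mulmxBr mulmxA PhiV mul1mx subrr.
have PhiA (x : 'cV_n) : Phi *m (closed_loop Sigma F *m x) = L *m (Phi *m x).
  rewrite -{1}[x](subrK (V *m (Phi *m x))).
  rewrite (mulmxDr (closed_loop _ _)) (mulmxDr Phi) (AVg _ (splitV x)).
  have /eqP -> : Phi *m (closed_loop Sigma F0 *m (x - V *m (Phi *m x))) == 0.
    by rewrite -VgPhi invF0.
  by rewrite add0r (mulmxA _ V) AV -[V *m L *m _]mulmxA (mulmxA Phi) PhiV mul1mx.
have EPhi (x : 'cV_n) : error_map Sigma F *m x = Gam *m (Phi *m x).
  rewrite -{1}[x](subrK (V *m (Phi *m x))) (mulmxDr (error_map _ _)) EVg //.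
  by rewrite add0r mulmxA.
exists F; apply/solves_single_modeP; split.
  apply/stable_matrixP => z eigz.
  have [|||[j ->]|] := @eigenvalue_on_quotient _ _ _ _ (closed_loop Sigma F0)
    Vg _ Phi lambda z _ _ _ eigz.
  - by move=> x _ j; rewrite PhiA mul_diag_mx !mxE.
  - by move=> x _ Px; rewrite VgPhi Px.
  - exact: AVg.
  - exact: lam_good.
  - exact: stF0.
move=> xi k; rewrite !EPhi PhiA mulmxA GamL -mulmxA mul_diag_mx.
by rewrite mxE [in X in X * _]mxE.
Qed.

End Synthesis.

Theorem theorem1 (R : realType) (tau : time_domain) (n m p : nat)
    (Sigma : lti_system R n m p) (Vg : {vspace 'cV[R]_n})
    (lambda : 'I_p -> R)
    (input_cols_free : row_free (col_mx (sysB Sigma) (sysD Sigma))^T)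
    (output_rows_free : row_free (row_mx (sysC Sigma) (sysD Sigma)))
    (Sigma_right_invertible : right_invertible Sigma)
    (Sigma_stabilisable : stabilisable tau Sigma)
    (no_steady_zero :
       ~ invariant_zeros Sigma (match tau with ContinuousTime => 0 | DiscreteTime => 1 end))
    (simple_min_phase_zeros : forall z : R[i],
       invariant_zeros Sigma z -> Cgood tau z -> has_alg_multiplicity Sigma z 1)
    (Vg_largest : is_Vgstar tau Sigma Vg)
    (dim_Vg : (\dim Vg + p)%N = n)
    (lambda_not_zero : forall i, ~ invariant_zeros Sigma (lambda i)%:C)
    (lambda_stable : forall i,
       match tau with
       | ContinuousTime => lambda i < 0
       | DiscreteTime => 0 < lambda i < 1
       end) :
  (exists F : 'M[R]_(m, n), solves_single_mode_problem tau Sigma lambda F) <->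
  (forall S : {set 'I_p},
     (n - p + #|S| <= \dim (Vg + \sum_(j in S) Rstar Sigma j (lambda j))%VS)%N).
Proof.
have dimVgE : \dim Vg = (n - p)%N by rewrite -[in RHS]dim_Vg addnK.
split=> [[F /solves_single_modeP[stF modes]] S | rank_cond].
- set E := error_map Sigma F in modes.
  have EA : E *m closed_loop Sigma F = diag_mx (\row_k lambda k) *m E.
    apply: eq_mulmx_col => x; rewrite -!mulmxA mul_diag_mx.
    by apply/colP => k; rewrite modes mxE [in RHS]mxE.
  have [VgE _] := Vgstar_eq_ker_error Vg_largest dim_Vg stF EA.
  set U := (Vg + _)%VS; pose f := linfun (@mulmx R p n 1 E).
  (* Rank-nullity for [E] on [U]: the kernel part contains [Vg], the image contains e_j for each [j]
     in [S]. *)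
  rewrite -(limg_ker_dim f U) -dimVgE leq_add //.
    apply: dimvS; rewrite subv_cap addvSl; apply/subvP => x.
    by rewrite VgE memv_ker lfunE.
  apply: dim_ge_deltas => j jS.
  have [v vR Ev] := modal_direction Vg_largest Sigma_right_invertible dim_Vg
    stF EA (lambda_not_zero j).
  apply/memv_imgP; exists v; last by rewrite lfunE /= Ev.
  apply: (subvP (addvSr _ _)); apply: subvP vR.
  exact: (sumv_sup j).
- have [S _|v vR rkv] :=
    @rado_vspace R _ _ Vg (fun j => Rstar Sigma j (lambda j)) [set: 'I_p].
    by rewrite dimVgE; exact: rank_cond.
  apply: (synthesis (proj1 Vg_largest) dim_Vg (v := v)).
  + move=> j; have := lambda_stable j; case: (tau) => //= /andP[l0 l1].
    by rewrite ger0_norm ?lecR ?(ltW l0) // (@ltcR R _ 1).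
  + by move=> j; apply: vR; rewrite inE.
  (* Rado's bound for the full index set is [\dim Vg + p], which is [n], so the chosen vectors
     complete [Vg] to the whole space. *)
  + apply/eqP; rewrite eqEdim subvf dimvf /dim /= muln1 -{1}dim_Vg.
    move: rkv; rewrite cardsT card_ord => /leq_trans; apply; rewrite dimvS //.
    by under eq_bigl do rewrite inE.
Qed.
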